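(* Let $Q\ge 0$ be an integer and let $K_0,K_1,\gamma_0,\gamma_1,\xi_0,\xi_1,\eta_0,\eta_1,V_0$ be real parameters with $$\eta_0=0,\qquad \xi_0=1,\qquad 2(1-\gamma_0)K_1-2\gamma_1K_0+\xi_1-\eta_1=0,\qquad K_0\neq 0,$$ $$\tfrac32+V_0-2K_0-2\xi_0=0,\qquad (1-\gamma_0)K_0+\tfrac12\xi_0-\eta_0-\tfrac12=0 .$$ Put $C:=(-1+\gamma_0+\gamma_1)K_0+(1-\gamma_0)K_1-\tfrac72\xi_1+\eta_0-\eta_1$. Let $f_{Q0},f_{Q1},\dots,f_{QQ}$ be complex numbers, not all zero, such that for every non-negative integer $s$ $$\sum_{S=s}^{Q} f_{QS}\binom{S}{s}\left[(\xi_0-1)(Q-S)+2K_0\left(Q-S\,\frac{s+2}{s+1}+\frac{s}{s+1}\right)+C\right]=0$$ and for every non-negative integer $r$ $$\sum_{R=r}^{Q} f_{Q,Q-R}\binom{R}{r}\left[(\xi_0-1)(Q-R)+2K_0\left(Q-R\,\frac{r+2}{r+1}+\frac{r}{r+1}\right)+C\right]=0 .$$ Then $f_{Q0}=f_{Q1}=\cdots=f_{QQ}$ (and conversely, when $C=0$, every tuple with all entries equal satisfies both families of equations). Consequently, for all real $\Lambda>0$, $a_*>0$ and all non-negative integers $m,n$, the quantity $$b_{mn}:=\sum_{S=0}^{Q} f_{QS}\sum_{r=0}^{Q-S}\sum_{s=0}^{S}\binom{Q-S}{r}\binom{S}{s}\frac{(-2\sqrt{\Lambda}\,a_*m)^r(-2\sqrt{\Lambda}\,a_*n)^s}{r!\,s!}$$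 equals $$f_{Q0}\,(Q+1)\sum_{s=0}^{Q}\binom{Q}{s}\frac{(-2\sqrt{\Lambda}\,a_* )^s(m+n)^s}{(s+1)!},$$ so $b_{mn}$, and hence $a_{mn}=b_{mn}p^{m+n}$ for any fixed number $p$, depends on $(m,n)$ only through $m+n$ (homogeneous matter distribution).
   Context: Sums over an empty range are zero, and $0^0=1$. Background (interpretation only): in a one-particle string bit model, $a_{mn}$ is the coefficient, in an energy eigenstate, of the basis state with $m$ empty links to the left and $n$ empty links to the right of the matter link, written $a_{mn}=b_{mn}p^{m+n}$; the formula defining $b_{mn}$ in the claim is its leading-order form in the continuum limit $a_*\to 0$. The model parameters $V,K,\gamma,\xi,\eta$ are expanded as $V=V_0+V_1\sqrt{\Lambda}a_*+\cdots$, $K=K_0+K_1\sqrt{\Lambda}a_*+\cdots$, and so on; the equations in the claim are the conditions imposed by the existence of the continuum limit, and ''homogeneous'' means that $a_{mn}$ depends only on $m+n$. *)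

(* Defs.v *)
From mathcomp Require Import all_boot all_order all_algebra.
From mathcomp Require Import reals complex.

Set Implicit Arguments.
Unset Strict Implicit.
Unset Printing Implicit Defensive.

Import Order.TTheory GRing.Theory Num.Theory.
Local Open Scope ring_scope.
Local Open Scope complex_scope.

(* A tuple f_{Q0}, ..., f_{QQ} is a function f : 'I_Q.+1 -> R[i], with
   f S = f_{QS}; hence f (rev_ord T) = f_{Q,Q-T}. *)

Definition bracket (R : realType) (xi0 K0 C : R) (Q S s : nat) : R :=
  (xi0 - 1) * (Q%:R - S%:R)
  + 2 * K0 * (Q%:R - S%:R * ((s%:R + 2) / (s%:R + 1)) + s%:R / (s%:R + 1))
  + C.

Definition s_equations (R : realType) (xi0 K0 C : R) (Q : nat)
    (f : 'I_Q.+1 -> R[i]) : Prop :=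
  forall s : nat,
    \sum_(S < Q.+1 | (s <= S)%N)
      f S * 'C(S, s)%:R * (bracket xi0 K0 C Q S s)%:C = 0.

Definition r_equations (R : realType) (xi0 K0 C : R) (Q : nat)
    (f : 'I_Q.+1 -> R[i]) : Prop :=
  forall r : nat,
    \sum_(T < Q.+1 | (r <= T)%N)
      f (rev_ord T) * 'C(T, r)%:R * (bracket xi0 K0 C Q T r)%:C = 0.

Definition b_coef (R : realType) (Q : nat) (f : 'I_Q.+1 -> R[i])
    (Lambda a : R) (m n : nat) : R[i] :=
  \sum_(S < Q.+1) f S *
    (\sum_(r < (Q - S).+1) \sum_(s < S.+1)
       'C(Q - S, r)%:R * 'C(S, s)%:R
       * ((- 2 * Num.sqrt Lambda * a * m%:R) ^+ r
          * (- 2 * Num.sqrt Lambda * a * n%:R) ^+ s)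
       / (r`!%:R * s`!%:R))%:C.

Definition a_coef (R : realType) (Q : nat) (f : 'I_Q.+1 -> R[i])
    (Lambda a : R) (p : R[i]) (m n : nat) : R[i] :=
  b_coef f Lambda a m n * p ^+ (m + n).

Definition homogeneous (T : Type) (g : nat -> nat -> T) : Prop :=
  forall m n m' n' : nat, (m + n = m' + n')%N -> g m n = g m' n'.

(* Main.v *)
Require Import Defs.
From mathcomp Require Import all_boot all_order all_algebra.
From mathcomp Require Import reals complex.
From mathcomp Require Import ring zify.

Set Implicit Arguments.
Unset Strict Implicit.
Unset Printing Implicit Defensive.

Import Order.TTheory GRing.Theory Num.Theory.
Local Open Scope ring_scope.
Local Open Scope complex_scope.

(** With [xi0 = 1], the identity ['C(S, s) (S - s) / (s + 1) = 'C(S, s + 1)] and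
    the hockey-stick formula turn the [s]-equations into the vanishing of the
    binomial transform of [u_j = (Q - j + c) f_j - \sum_(S > j) f_S], where
    [c = C / (2 K0)].  This transform is injective, so [u = 0]; symmetrically
    the [r]-equations say [(i + c) f_i = \sum_(S < i) f_S].  Adding the two,
    [(Q + 1 + 2 c) f_i = \sum_S f_S] does not depend on [i].  In the degenerate
    case [c = - (Q + 1) / 2] the coefficient [i + c] is nonzero for every
    [i < (Q + 1) / 2], so both triangular systems force [f = 0].
    For constant [f], the Vandermonde-type convolution
    [\sum_S 'C(Q - S, r) 'C(S, s) = 'C(Q + 1, r + s + 1)] and the binomial
    theorem give the closed form of [b_mn]. *)

(** * Binomial identities and rearrangement of sums *)

Lemma hockey_stick n m : (\sum_(j < n) 'C(j, m) = 'C(n, m.+1))%N.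
Proof.
elim: n => [|n IHn]; first by rewrite big_ord0 bin0n.
by rewrite big_ord_recr /= IHn binS.
Qed.

(** An (r + s + 1)-subset of {0, ..., n} with exactly s elements below its member k has r elements
    among the n - k above it. The proof is an induction with Pascal's rule. *)
Lemma sum_bin_convolution n r s :
  (\sum_(k < n.+1) 'C(n - k, r) * 'C(k, s) = 'C(n.+1, (r + s).+1))%N.
Proof.
elim: n r s => [|n IHn] r s.
  rewrite big_ord1 subn0 binS !bin0n addnC /=.
  by case: r => [|r]; case: s.
rewrite big_ord_recl /= subn0; under eq_bigr do rewrite /bump /= add1n subSS.
(* For s = 0 the split-off term k = 0 is the summand 'C(n + 1, r) of Pascal's rule; for s > 0 it
   vanishes and the rule is applied to the second factor. *)
case: s => [|s].
  under eq_bigr => k _ do rewrite bin0 -(bin0 k).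
  by rewrite IHn addn0 bin0 muln1 [RHS]binS addnC.
under eq_bigr do rewrite binS mulnDr.
by rewrite bin0n muln0 add0n big_split /= !IHn addnS [RHS]binS.
Qed.

Lemma sum_ord_widen_zero (V : nmodType) (n m : nat) (F : nat -> V) :
    (n <= m)%N -> (forall i, (n <= i)%N -> F i = 0) ->
  \sum_(i < n) F i = \sum_(i < m) F i.
Proof.
move=> le_nm F0; rewrite (big_ord_widen m F le_nm) big_mkcond /=.
by apply: eq_bigr => i _; case: ltnP => // /F0.
Qed.

(** Raising n by one appends one entry to every row, and these entries form the new antidiagonal. *)
Lemma sum_triangle_antidiagonal (V : nmodType) (n : nat) (H : nat -> nat -> V) :
  \sum_(r < n) \sum_(s < n - r) H r s
    = \sum_(k < n) \sum_(r < k.+1) H r (k - r)%N.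
Proof.
elim: n => [|n IHn]; first by rewrite !big_ord0.
rewrite big_ord_recr [RHS]big_ord_recr /= -IHn subSn // subnn big_ord1.
rewrite [in RHS]big_ord_recr /= subnn addrA -big_split /=; congr (_ + _).
by apply: eq_bigr => r _; rewrite subSn 1?ltnW // big_ord_recr.
Qed.

(** * Binomial transform and the triangular form of the s-equations *)

Lemma binomial_transform_inj (K : numDomainType) n (u : 'I_n -> K) :
  (forall s, \sum_(j < n) u j * 'C(j, s)%:R = 0) -> forall j, u j = 0.
Proof.
(* Descending induction on j: in the equation s = j, terms i < j vanish with 'C(i, j), terms i > j
   by induction, and the coefficient at j is 1. *)
move=> u0 j; have [k] := ubnP (n - j); elim: k j => // k IHk j le_jk.
have := u0 j; rewrite (bigD1 j) //= binn mulr1 big1 ?addr0 // => i ne_ij.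
have [lt_ij|lt_ji|/val_inj eq_ij] := ltngtP i j.
- by rewrite bin_small ?mulr0.
- by rewrite IHk ?mul0r //; have := ltn_ord i; lia.
- by rewrite eq_ij eqxx in ne_ij.
Qed.

Lemma binomial_transform_shift (K : comNzRingType) n (f : 'I_n -> K) s :
  \sum_(S < n) f S * 'C(S, s.+1)%:R
    = \sum_(j < n) (\sum_(S < n | (j < S)%N) f S) * 'C(j, s)%:R.
Proof.
under eq_bigr => S _.
  rewrite -hockey_stick.
  rewrite (big_ord_widen n (fun j => 'C(j, s)) (ltnW (ltn_ord S))).
  rewrite natr_sum mulr_sumr; over.
rewrite (exchange_big_dep xpredT) //=.
by apply: eq_bigr => j _; rewrite mulr_suml.
Qed.

(** Here S (s + 2) / (s + 1) - s / (s + 1) = S + (S - s) / (s + 1), and 'C(S, s) absorbs the last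
    fraction. *)
Lemma bracket_bin (R : realType) (K0 C : R) (Q S s : nat) : (s <= S)%N ->
  'C(S, s)%:R * (bracket 1 K0 C Q S s)%:C
    = (2 * K0 * (Q%:R - S%:R) + C)%:C * 'C(S, s)%:R
      - (2 * K0)%:C * 'C(S, s.+1)%:R :> R[i].
Proof.
move=> le_sS; rewrite -!(rmorph_nat (real_complex R)) -!rmorphM -rmorphB.
congr (_%:C); rewrite /bracket.
have s1_neq0 : s%:R + 1 != 0 :> R by rewrite natr1 pnatr_eq0.
have bin_s1 : 'C(S, s.+1)%:R = 'C(S, s)%:R * (S%:R - s%:R) / (s%:R + 1) :> R.
  apply: (canRL (mulfK s1_neq0)).
  by rewrite natr1 -natrB // -!natrM mulnC mul_bin_left mulnC.
by rewrite bin_s1; field.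
Qed.

Lemma s_equationsP (R : realType) (K0 C : R) (Q : nat) (f : 'I_Q.+1 -> R[i]) :
  s_equations 1 K0 C f <->
  forall j : 'I_Q.+1,
    (2 * K0 * (Q%:R - j%:R) + C)%:C * f j
      = (2 * K0)%:C * \sum_(S < Q.+1 | (j < S)%N) f S.
Proof.
pose u (j : 'I_Q.+1) := (2 * K0 * (Q%:R - j%:R) + C)%:C * f j
      - (2 * K0)%:C * \sum_(S < Q.+1 | (j < S)%N) f S.
have uE s : \sum_(S < Q.+1 | (s <= S)%N)
      f S * 'C(S, s)%:R * (bracket 1 K0 C Q S s)%:C
    = \sum_(j < Q.+1) u j * 'C(j, s)%:R.
  under [RHS]eq_bigr => j _ do
    rewrite mulrBl -[X in X - _]mulrA -[X in _ - X]mulrA.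
  rewrite sumrB -mulr_sumr -binomial_transform_shift mulr_sumr -sumrB.
  rewrite big_mkcond; apply: eq_bigr => S _; case: leqP => [le_sS|lt_Ss].
    by rewrite -mulrA bracket_bin //; ring.
  by rewrite !bin_small ?mulr0 ?subrr // ltnW.
split=> [seq j|fE s].
  apply/eqP; rewrite -subr_eq0; apply/eqP.
  by apply: (binomial_transform_inj (u := u)) => s; rewrite -uE.
by rewrite uE big1 // => j _; rewrite /u fE subrr mul0r.
Qed.

(** * Index reversal and the pair of triangular systems *)

Lemma natr_rev_ord (K : pzRingType) Q (j : 'I_Q.+1) :
  (rev_ord j)%:R = Q%:R - j%:R :> K.
Proof. by rewrite /= subSS natrB // -ltnS. Qed.

Lemma sum_rev_ord_gt (V : nmodType) Q (f : 'I_Q.+1 -> V) (i : 'I_Q.+1) :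
  \sum_(S < Q.+1 | (rev_ord i < S)%N) f (rev_ord S)
    = \sum_(S < Q.+1 | (S < i)%N) f S.
Proof.
rewrite [RHS](reindex_inj rev_ord_inj) /=; apply: eq_bigl => S.
by have := ltn_ord i; have := ltn_ord S; lia.
Qed.

Lemma sum_rev_ord_lt (V : nmodType) Q (f : 'I_Q.+1 -> V) (i : 'I_Q.+1) :
  \sum_(S < Q.+1 | (S < i)%N) f (rev_ord S)
    = \sum_(S < Q.+1 | (rev_ord i < S)%N) f S.
Proof.
rewrite -(sum_rev_ord_gt (f \o @rev_ord _)) /=.
by apply: eq_bigr => S _; rewrite rev_ordK.
Qed.

(** Since i + c = (2 i - Q - 1) / 2 is nonzero in the lower half, forward substitution from i = 0
    gives zero there. *)
Lemma lower_triangular_eq0 (K : numFieldType) Q (c : K) (f : 'I_Q.+1 -> K) :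
    Q.+1%:R + 2 * c = 0 ->
    (forall i : 'I_Q.+1, (i%:R + c) * f i = \sum_(S < Q.+1 | (S < i)%N) f S) ->
  forall i : 'I_Q.+1, (i.*2 < Q.+1)%N -> f i = 0.
Proof.
move=> c_eq fE i; have [k] := ubnP (i : nat).
elim: k i => // k IHk i lt_ik lt_iQ.
have /eqP := fE i; rewrite big1 => [|S lt_Si]; last by apply: IHk; lia.
rewrite mulf_eq0 => /orP[/eqP ic0|/eqP //].
have : i.*2%:R - Q.+1%:R = 0 :> K.
  have -> : i.*2%:R - Q.+1%:R = 2 * (i%:R + c) - (Q.+1%:R + 2 * c) :> K.
    by rewrite -mul2n natrM; ring.
  by rewrite ic0 c_eq mulr0 subrr.
by move/eqP; rewrite subr_eq0 eqr_nat => /eqP eq_iQ;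
  rewrite eq_iQ ltnn in lt_iQ.
Qed.

Lemma two_sided_triangular_const (K : numFieldType) Q (c : K)
    (f : 'I_Q.+1 -> K) :
    (forall j : 'I_Q.+1,
       (Q%:R - j%:R + c) * f j = \sum_(S < Q.+1 | (j < S)%N) f S) ->
    (forall i : 'I_Q.+1, (i%:R + c) * f i = \sum_(S < Q.+1 | (S < i)%N) f S) ->
  forall i j : 'I_Q.+1, f i = f j.
Proof.
move=> f_gt f_lt.
have f_sum i : (Q.+1%:R + 2 * c) * f i = \sum_(S < Q.+1) f S.
  rewrite (bigD1 i) //= (bigID (fun S : 'I_Q.+1 => (S < i)%N)) /=.
  rewrite (eq_bigl (fun S : 'I_Q.+1 => (S < i)%N)) => [|S]; last first.
    by rewrite -val_eqE /=; lia.
  rewrite [X in _ + (_ + X)](eq_bigl (fun S : 'I_Q.+1 => (i < S)%N)) => [|S].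
    by rewrite -f_gt -f_lt -natr1; ring.
  by rewrite -val_eqE /=; lia.
have [c_eq|c_neq] := eqVneq (Q.+1%:R + 2 * c) 0; last first.
  by move=> i j; apply: (mulfI c_neq); rewrite !f_sum.
suff f0 i : f i = 0 by move=> i j; rewrite !f0.
have [lt_iQ|le_Qi] := ltnP i.*2 Q.+1; first exact: (lower_triangular_eq0 c_eq).
(* Reversal sends the upper half into the lower half and exchanges the two systems. *)
rewrite -(rev_ordK i).
apply: (lower_triangular_eq0 (f := f \o @rev_ord _) c_eq) => [j|] /=.
  by rewrite (sum_rev_ord_lt f) -f_gt natr_rev_ord subKr.
by have := ltn_ord i; lia.
Qed.

(** * Closed form of the coefficients for a constant tuple *)

Lemma sum_bin_binomial_convolution (K : numFieldType) Q (x y : K) :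
  \sum_(S < Q.+1) \sum_(r < (Q - S).+1) \sum_(s < S.+1)
     'C(Q - S, r)%:R * 'C(S, s)%:R * (x ^+ r * y ^+ s) / (r`!%:R * s`!%:R)
  = Q.+1%:R * \sum_(k < Q.+1) 'C(Q, k)%:R * (x + y) ^+ k / k.+1`!%:R.
Proof.
pose g r s : K := x ^+ r * y ^+ s / (r`!%:R * s`!%:R).
transitivity (\sum_(r < Q.+1) \sum_(s < Q.+1) 'C(Q.+1, (r + s).+1)%:R * g r s).
  (* The ranges of r and s are extended by vanishing binomials until they no longer depend on S, so
     that the sum over S can be done first. *)
  transitivity (\sum_(S < Q.+1) \sum_(r < Q.+1) \sum_(s < Q.+1)
     ('C(Q - S, r) * 'C(S, s))%:R * g r s).
    apply: eq_bigr => S _.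
    pose G r s := ('C(Q - S, r) * 'C(S, s))%:R * g r s.
    rewrite -(@sum_ord_widen_zero _ (Q - S).+1 _
      (fun r => \sum_(s < Q.+1) G r s)) ?ltnS ?leq_subr // => [|r lt_r].
      apply: eq_bigr => r _.
      rewrite -(@sum_ord_widen_zero _ S.+1 _ (G r)) // => [|s lt_s].
        by apply: eq_bigr => s _; rewrite /G /g natrM !mulrA.
      by rewrite /G (bin_small lt_s) muln0 mul0r.
    by rewrite big1 // => s _; rewrite /G (bin_small lt_r) mul0n mul0r.
  rewrite exchange_big /=; apply: eq_bigr => r _.
  rewrite exchange_big /=; apply: eq_bigr => s _.
  by rewrite -mulr_suml -natr_sum sum_bin_convolution.
(* Terms with r + s > Q vanish; the remaining triangle is summed along k = r + s. *)
transitivity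
  (\sum_(k < Q.+1) \sum_(r < k.+1) 'C(Q.+1, k.+1)%:R * g r (k - r)%N).
  pose G r s := 'C(Q.+1, (r + s).+1)%:R * g r s.
  transitivity (\sum_(r < Q.+1) \sum_(s < Q.+1 - r) G r s).
    apply: eq_bigr => r _; apply/esym/sum_ord_widen_zero => [|s le_s].
      exact: leq_subr.
    by rewrite /G bin_small ?mul0r //; have := ltn_ord r; lia.
  rewrite sum_triangle_antidiagonal; apply: eq_bigr => k _.
  by apply: eq_bigr => r _; rewrite /G subnKC // -ltnS.
rewrite mulr_sumr; apply: eq_bigr => k _.
have fact_neq0 n : n`!%:R != 0 :> K by rewrite pnatr_eq0 -lt0n fact_gt0.
have k1_neq0 : k.+1%:R != 0 :> K by rewrite pnatr_eq0.
(* The denominator k + 1 later turns k! into (k + 1)!. *)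
have -> : 'C(Q.+1, k.+1)%:R = Q.+1%:R * 'C(Q, k)%:R / k.+1%:R :> K.
  by apply: (canRL (mulfK k1_neq0)); rewrite -!natrM mulnC mul_bin_diag.
(* [exprDn] gives the exponent k - r to the first summand, hence the swap to y + x. *)
rewrite -mulr_sumr addrC exprDn factS natrM.
have -> : \sum_(r < k.+1) g r (k - r)%N
    = (\sum_(r < k.+1) y ^+ (k - r) * x ^+ r *+ 'C(k, r)) / k`!%:R.
  rewrite mulr_suml; apply: eq_bigr => r _.
  have le_rk : (r <= k)%N by rewrite -ltnS.
  rewrite /g -(bin_fact le_rk) -mulr_natr !natrM.
  have bin_neq0 : 'C(k, r)%:R != 0 :> K by rewrite pnatr_eq0 -lt0n bin_gt0.
  by field; rewrite bin_neq0 !fact_neq0.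
by field; rewrite nat1r k1_neq0 fact_neq0.
Qed.

(** The two arguments of the convolution are the same multiple of m and of n, so their sum retains
    only m + n. *)
Lemma b_coef_const (R : realType) Q (f : 'I_Q.+1 -> R[i]) (Lambda a : R) m n :
    (forall S S', f S = f S') ->
  b_coef f Lambda a m n =
  f ord0 * (Q.+1%:R * \sum_(s < Q.+1)
     'C(Q, s)%:R * ((- 2 * Num.sqrt Lambda * a) ^+ s * (m + n)%:R ^+ s)
     / s.+1`!%:R)%:C.
Proof.
move=> f_const; rewrite /b_coef.
under eq_bigr => S _ do rewrite (f_const S ord0).
rewrite -mulr_sumr -rmorph_sum /= sum_bin_binomial_convolution.
congr (_ * (_ * _)%:C); apply: eq_bigr => k _.
by rewrite -mulrDr -natrD exprMn.
Qed.

(** * From the equations to constancy, and back *)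

Lemma s_r_equations_const (R : realType) (K0 C : R) Q (f : 'I_Q.+1 -> R[i]) :
    K0 != 0 -> s_equations 1 K0 C f -> r_equations 1 K0 C f ->
  forall S S', f S = f S'.
Proof.
move=> K0_neq0 /s_equationsP s_eqs r_eqs.
(* The r-equations of [f] are, by conversion, the s-equations of the reversed tuple. *)
have /s_equationsP {}r_eqs : s_equations 1 K0 C (f \o @rev_ord _) by [].
have K_neq0 : (2 * K0)%:C != 0.
  by rewrite fmorph_eq0 mulf_neq0 // pnatr_eq0.
have KcE (x : R) : (2 * K0)%:C * (x%:C + (C / (2 * K0))%:C)
    = (2 * K0 * x + C)%:C.
  by rewrite -rmorphD -rmorphM; congr (_%:C); field.
apply: (two_sided_triangular_const (c := (C / (2 * K0))%:C)) => j;
  apply: (mulfI K_neq0); rewrite mulrA.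
  rewrite -s_eqs -KcE rmorphB !rmorph_nat; ring.
(* Read at Q - j, the reversed system has the coefficient Q - (Q - j) = j. *)
have := r_eqs (rev_ord j).
rewrite natr_rev_ord /= rev_ordK (sum_rev_ord_gt f) => <-.
rewrite -KcE subKr rmorph_nat; ring.
Qed.

Lemma const_s_equations (R : realType) (K0 : R) Q (f : 'I_Q.+1 -> R[i]) :
  (forall S S', f S = f S') -> s_equations 1 K0 0 f.
Proof.
move=> f_const; apply/s_equationsP => j.
under eq_bigr => S _ do rewrite (f_const S j).
rewrite addr0 rmorphM -mulrA; congr (_ * _).
(* The indices above j are counted by reflecting them onto the initial segment below Q - j. *)
have := sum_rev_ord_lt (fun=> f j) (rev_ord j); rewrite rev_ordK => <-.
rewrite -(big_ord_widen _ (fun=> f j) (ltnW (ltn_ord (rev_ord j)))).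
rewrite sumr_const card_ord -[f j *+ _]mulr_natl natr_rev_ord.
by rewrite rmorphB !rmorph_nat.
Qed.

Theorem mainTheorem1 (R : realType) (Q : nat)
    (K0 K1 gamma0 gamma1 xi0 xi1 eta0 eta1 V0 : R)
    (h_eta0 : eta0 = 0)
    (h_xi0 : xi0 = 1)
    (h_first : 2 * (1 - gamma0) * K1 - 2 * gamma1 * K0 + xi1 - eta1 = 0)
    (h_K0 : K0 <> 0)
    (h_V0 : 3 / 2 + V0 - 2 * K0 - 2 * xi0 = 0)
    (h_gamma0 : (1 - gamma0) * K0 + 1 / 2 * xi0 - eta0 - 1 / 2 = 0) :
  let C : R := (-1 + gamma0 + gamma1) * K0 + (1 - gamma0) * K1
               - 7 / 2 * xi1 + eta0 - eta1 in
  (forall f : 'I_Q.+1 -> R[i],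
     (exists S : 'I_Q.+1, f S <> 0) ->
     s_equations xi0 K0 C f ->
     r_equations xi0 K0 C f ->
     (forall S S' : 'I_Q.+1, f S = f S')
     /\ (forall Lambda a : R, 0 < Lambda -> 0 < a ->
           (forall m n : nat,
              b_coef f Lambda a m n =
              f ord0 * (Q.+1%:R * \sum_(s < Q.+1)
                 'C(Q, s)%:R
                 * ((- 2 * Num.sqrt Lambda * a) ^+ s * (m + n)%:R ^+ s)
                 / s.+1`!%:R)%:C)
           /\ homogeneous (b_coef f Lambda a)
           /\ (forall p : R[i], homogeneous (a_coef f Lambda a p))))
  /\ (C = 0 ->
      forall f : 'I_Q.+1 -> R[i],
        (forall S S' : 'I_Q.+1, f S = f S') ->
        s_equations xi0 K0 C f /\ r_equations xi0 K0 C f).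
Proof.
have K0_neq0 : K0 != 0 by apply/eqP.
rewrite h_xi0 => C; split=> [f _ s_eqs r_eqs | C0 f f_const].
  have f_const := s_r_equations_const K0_neq0 s_eqs r_eqs.
  split=> // Lambda a _ _.
  have b_hom : homogeneous (b_coef f Lambda a).
    by move=> m n m' n' eq_mn; rewrite !b_coef_const // eq_mn.
  split=> [m n|]; first exact: b_coef_const.
  split=> // p m n m' n' eq_mn.
  by rewrite /a_coef eq_mn (b_hom _ _ _ _ eq_mn).
rewrite C0; split; first exact: const_s_equations.
by apply: (const_s_equations _ (f := f \o @rev_ord _)) => S S' /=.
Qed.
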